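(* Every set system $\Omega\subseteq\mathscr P([n])$ admits a decomposition $\Omega=\bigcup_{k\in K}\Omega_k$ for some interval set systems $\{\Omega_k\}_{k\in K}$ ($K$ finite), which leads to the following exact reformulation of the problem $\min_{x\in\mathcal X_\Omega}f(x)$, for $f:\{0,1\}^n\to\mathbb R$: $$\begin{aligned}\min_{x\in\{0,1\}^n,\ z\in\{0,1\}^{|K|}}\ & f(x)\\ \text{s.t.}\ & \sum_{i\in T}x_i\ge z_k, && \forall k\in K,\ \forall T\in m\big(\widehat{\overline{\uparrow\Omega_k}}\big),\\ & \sum_{i\in T}x_i\le |T|-z_k, && \forall k\in K,\ \forall T\in m\big(\overline{\downarrow\Omega_k}\big),\\ & \sum_{k\in K}z_k=1,\end{aligned}$$ where $z_k$ represents the set system to which the optimal solution belongs.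
   Context: $\Delta:=[n]$; a set system is a subset of the power set $\mathscr P(\Delta)$. A set system $\Omega$ is an interval system if for all $T,T'\in\Omega$ and any $T''$ with $T\subseteq T''\subseteq T'$ we have $T''\in\Omega$. $\mathcal X_\Omega\subseteq\{0,1\}^n$ is the set of indicator vectors of members of $\Omega$. $\uparrow\Omega:=\{T\subseteq\Delta\mid T\supseteq T'\text{ for some }T'\in\Omega\}$; $\downarrow\Omega:=\{T\subseteq\Delta\mid T\subseteq T'\text{ for some }T'\in\Omega\}$; $\overline\Omega:=\mathscr P(\Delta)\setminus\Omega$; $\widehat\Omega:=\{\Delta\setminus T\mid T\in\Omega\}$; $m(\Omega)$ is the family of inclusion-minimal members of $\Omega$. ''Exact reformulation'' means that $x\in\mathcal X_\Omega$ if and only if there exists $z$ such that $(x,z)$ is feasible for the displayed problem (so the optimal values agree); $z_k=1$ means $x\in\mathcal X_{\Omega_k}$. Infeasible minimization problems have value $+\infty$; empty sums are $0$. *)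

(* Defs.v *)
From HB Require Import structures.
From mathcomp Require Import all_boot all_order all_algebra.
From mathcomp Require Import reals constructive_ereal.

Set Implicit Arguments.
Unset Strict Implicit.
Unset Printing Implicit Defensive.

Import Order.TTheory GRing.Theory Num.Theory.

Local Open Scope ring_scope.

(* The ground set [n] is 'I_n, and a set system on it is a value of type
   {set {set 'I_n}}. *)

Definition interval_system (n : nat) (Om : {set {set 'I_n}}) : Prop :=
  forall T T' T'' : {set 'I_n},
    T \in Om -> T' \in Om -> T \subset T'' -> T'' \subset T' -> T'' \in Om.

(* {0,1}^n is {ffun 'I_n -> bool}. *)
Definition indicator (n : nat) (T : {set 'I_n}) : {ffun 'I_n -> bool} :=
  [ffun i => i \in T].

Definition indicators (n : nat) (Om : {set {set 'I_n}}) :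
    {set {ffun 'I_n -> bool}} :=
  [set indicator T | T in Om].

Definition up_closure (n : nat) (Om : {set {set 'I_n}}) : {set {set 'I_n}} :=
  [set T : {set 'I_n} | [exists T' in Om, T' \subset T]].

Definition down_closure (n : nat) (Om : {set {set 'I_n}}) : {set {set 'I_n}} :=
  [set T : {set 'I_n} | [exists T' in Om, T \subset T']].

(* Memberwise complement, as opposed to the complement ~: Om of the family. *)
Definition co_members (n : nat) (Om : {set {set 'I_n}}) : {set {set 'I_n}} :=
  [set ~: T | T in Om].

Definition minimal_members (n : nat) (Om : {set {set 'I_n}}) :
    {set {set 'I_n}} :=
  [set T : {set 'I_n} | minset (mem Om) T].

Definition interval_decomposition (n : nat) (Om : {set {set 'I_n}})
    (K : finType) (Omk : K -> {set {set 'I_n}}) : Prop :=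
  (forall k, interval_system (Omk k)) /\ Om = \bigcup_(k : K) Omk k.

(* The inequalities are over int: #|T| - z_k is -1 when T is empty and
   z_k = 1, so truncated subtraction would change the constraint. *)
Definition feasible (n : nat) (K : finType) (Omk : K -> {set {set 'I_n}})
    (x : {ffun 'I_n -> bool}) (z : {ffun K -> bool}) : bool :=
  [&& [forall k : K,
        [forall T in minimal_members (co_members (~: up_closure (Omk k))),
          (z k)%:Z <= \sum_(i in T) (x i)%:Z]],
      [forall k : K,
        [forall T in minimal_members (~: down_closure (Omk k)),
          \sum_(i in T) (x i)%:Z <= #|T|%:Z - (z k)%:Z]]
    & \sum_(k : K) (z k)%:Z == 1].

(* Value of min F over the points satisfying P, with value +oo if there are
   none; the index set is finite, so otherwise the minimum is attained. *)
Definition min_value (R : realType) (I : finType) (P : pred I) (F : I -> R) :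
    \bar R :=
  \big[Order.min/+oo%E]_(i : I | P i) (F i)%:E.

(* Main.v *)
Require Import Defs.
From HB Require Import structures.
From mathcomp Require Import all_boot all_order all_algebra.
From mathcomp Require Import reals constructive_ereal.

Set Implicit Arguments.
Unset Strict Implicit.
Unset Printing Implicit Defensive.

Import Order.TTheory GRing.Theory Num.Theory.

Local Open Scope ring_scope.

(** Let [S] be the support of [x]. Singletons are interval systems, so every
    set system decomposes. The reformulation rests on two facts.

    An interval system is the intersection of its upward and its downward
    closure: a set lying above one member and below another is a member
    ([interval_systemE]).

    Each closure is described by set inequalities. [S] lies in an up-set [U]
    exactly when it meets the complement of every non-member of [U]: a set [V]
    outside [U] with [S] disjoint from its complement would contain [S], and
    [S] itself is such a [V] if it lies outside [U]
    ([forall_up_closure]). Dually, [S] lies in a down-set [D] exactly when it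
    contains no non-member of [D] ([forall_down_closure]). Meeting a set, and
    not being included in [S], are both inherited by larger sets, so only the
    minimal sets need testing ([forall_minimal_members]).

    As the sum of the [x_i] over [T] counts the points of [T] in [S], the
    constraints at [k] read: if [z_k = 1] then [S] lies in both closures of
    [Omk k], and they are vacuous if [z_k = 0]. Since the [z_k] sum to [1],
    feasibility of [(x, z)] means that [z] selects one index [k] and [S]
    belongs to [Omk k] ([feasibleP]). Projecting on [x] gives the union of the
    [Omk k], and the objective depends on [x] alone, so the two optimal values
    agree, including [+oo] when there is no feasible point
    ([min_value_projection]). *)

Lemma mem_indicators (n : nat) (Om : {set {set 'I_n}})
    (x : {ffun 'I_n -> bool}) :
  (x \in indicators Om) = ([set i | x i] \in Om).
Proof.
apply/imsetP/idP => [[T TOm ->]|SOm].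
  by rewrite (_ : [set i | _] = T) //; apply/setP=> i; rewrite inE ffunE.
by exists [set i | x i] => //; apply/ffunP=> i; rewrite ffunE inE.
Qed.

Lemma sum_bool (I : finType) (P : pred I) (x : I -> bool) :
  \sum_(i | P i) (x i)%:Z = #|[set i | P i & x i]|%:Z.
Proof.
rewrite -sum1dep_card big_mkcondr /= (big_morph Posz PoszD (erefl 0%:Z)).
by apply: eq_bigr => i _; case: (x i).
Qed.

(** In a finite family every member contains a minimal one, from which a
    monotone property is inherited. *)
Lemma forall_minimal_members (n : nat) (G : {set {set 'I_n}})
    (P : pred {set 'I_n}) :
  (forall A B : {set 'I_n}, A \subset B -> P A -> P B) ->
  [forall T in minimal_members G, P T] = [forall T in G, P T].
Proof.
move=> mono; apply/forall_inP/forall_inP => PG T TG.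
  have [A minA sAT] := @minset_exists _ (mem G) T TG.
  by apply: mono sAT _; apply: PG; rewrite inE.
by apply: PG; move: TG; rewrite inE => /minsetP[].
Qed.

(** For [T = ~: U], meeting [S] amounts to [U] not containing [S], so a
    violated condition is a superset of [S] outside the closure; [T = ~: S]
    detects that [S] itself is outside. *)
Lemma forall_up_closure (n : nat) (Om : {set {set 'I_n}}) (S : {set 'I_n}) :
  [forall T in co_members (~: up_closure Om), ~~ [disjoint T & S]] =
  (S \in up_closure Om).
Proof.
apply/forall_inP/idP => [meets|].
  apply: contraT => SnU.
  move: (meets (~: S)); rewrite disjoint_sym disjoints_subset setCK subxx.
  by apply; apply: imset_f; rewrite inE.
rewrite inE => /exists_inP[A AOm sAS] _ /imsetP[U UnU ->].
apply: contraL UnU; rewrite disjoint_sym disjoints_subset setCK => sSU.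
by rewrite !inE negbK; apply/exists_inP; exists A => //; apply: subset_trans sSU.
Qed.

Lemma forall_down_closure (n : nat) (Om : {set {set 'I_n}}) (S : {set 'I_n}) :
  [forall T in ~: down_closure Om, ~~ (T \subset S)] =
  (S \in down_closure Om).
Proof.
apply/forall_inP/idP => [escapes|].
  by apply: contraT => SnD; move: (escapes S); rewrite subxx inE; apply.
rewrite inE => /exists_inP[A AOm sSA] U; apply: contraL => sUS.
by rewrite !inE negbK; apply/exists_inP; exists A => //; apply: subset_trans sSA.
Qed.

Lemma interval_systemE (n : nat) (Om : {set {set 'I_n}}) (S : {set 'I_n}) :
  interval_system Om ->
  (S \in up_closure Om) && (S \in down_closure Om) = (S \in Om).
Proof.
move=> itv; rewrite !inE; apply/andP/idP.
  by case=> /exists_inP[A AOm sAS] /exists_inP[B BOm]; apply: itv sAS.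
by move=> SOm; split; apply/exists_inP; exists S.
Qed.

(** For [b = 1] each inequality asks that [T] meet the support; for [b = 0]
    it compares [0] with a cardinal. *)
Lemma covering_constraints (n : nat) (Om : {set {set 'I_n}})
    (x : {ffun 'I_n -> bool}) (b : bool) :
  [forall T in minimal_members (co_members (~: up_closure Om)),
     b%:Z <= \sum_(i in T) (x i)%:Z] =
  b ==> ([set i | x i] \in up_closure Om).
Proof.
rewrite -forall_up_closure -(@forall_minimal_members _ _
  (fun T => ~~ [disjoint T & [set i | x i]])); last first.
  by move=> A B sAB; apply: contra => /(disjointWl sAB).
have E (T : {set 'I_n}) : (b%:Z <= \sum_(i in T) (x i)%:Z) =
           b ==> ~~ [disjoint T & [set i | x i]].
  rewrite sum_bool -setI_eq0 lez_nat; case: b => //=.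
  rewrite card_gt0; congr (_ != _).
  by apply/setP=> i; rewrite !inE.
case: b E => /= E; first by apply: eq_forallb => T; rewrite E.
by apply/forall_inP=> T _; rewrite E.
Qed.

(** The slack [#|T| - \sum_(i in T) x i] counts the points of [T] outside the
    support, so for [b = 1] each inequality asks that [T] stick out of it. *)
Lemma packing_constraints (n : nat) (Om : {set {set 'I_n}})
    (x : {ffun 'I_n -> bool}) (b : bool) :
  [forall T in minimal_members (~: down_closure Om),
     \sum_(i in T) (x i)%:Z <= #|T|%:Z - b%:Z] =
  b ==> ([set i | x i] \in down_closure Om).
Proof.
rewrite -forall_down_closure -(@forall_minimal_members _ _
  (fun T => ~~ (T \subset [set i | x i]))); last first.
  by move=> A B sAB; apply: contra => /(subset_trans sAB).
have E (T : {set 'I_n}) : (\sum_(i in T) (x i)%:Z <= #|T|%:Z - b%:Z) =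
           b ==> ~~ (T \subset [set i | x i]).
  rewrite sum_bool -setD_eq0 -(cardsID [set i | x i] T) PoszD.
  rewrite (_ : [set i in T | x i] = T :&: [set i | x i]); last first.
    by apply/setP=> i; rewrite !inE.
  by rewrite -addrA lerDl subr_ge0 lez_nat; case: b; rewrite //= card_gt0.
case: b E => /= E; first by apply: eq_forallb => T; rewrite E.
by apply/forall_inP=> T _; rewrite E.
Qed.

(** A 0/1 vector with sum [1] is the indicator of a single index, whose block
    of constraints is the only one in force. *)
Lemma feasibleP (n : nat) (K : finType) (Omk : K -> {set {set 'I_n}})
    (x : {ffun 'I_n -> bool}) (z : {ffun K -> bool}) :
  (forall k, interval_system (Omk k)) ->
  reflect (exists2 k, z = [ffun j => j == k] & x \in indicators (Omk k))
          (feasible Omk x z).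
Proof.
move=> itv; rewrite /feasible.
under eq_forallb do rewrite covering_constraints.
under [X in _ && (X && _)]eq_forallb do rewrite packing_constraints.
rewrite sum_bool eqz_nat.
apply: (iffP and3P) => [[/forallP up /forallP dn /cards1P[k zk]]|[k -> xk]].
  have zE j : z j = (j == k) by have /setP/(_ j) := zk; rewrite !inE.
  exists k; first by apply/ffunP=> j; rewrite ffunE.
  rewrite mem_indicators -interval_systemE //.
  by move: (up k) (dn k); rewrite zE eqxx => /= -> ->.
move: xk; rewrite mem_indicators -interval_systemE // => /andP[Sup Sdn].
split; try by apply/forallP=> j; rewrite ffunE; case: eqP => // ->.
by apply/cards1P; exists k; apply/setP=> j; rewrite !inE ffunE.
Qed.

Lemma min_value_projection (R : realType) (I J : finType) (P : pred I)
    (Q : pred (I * J)) (f : I -> R) :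
  (forall i, P i <-> exists j, Q (i, j)) ->
  min_value P f = min_value Q (fun ij => f ij.1).
Proof.
move=> PQ; apply/le_anti/andP; split; apply/bigmin_geP; split=> //; try exact: leey.
  by move=> [i j] Qij; apply: bigmin_le_cond; apply/PQ; exists j.
by move=> i /PQ[j Qij]; apply: (@bigmin_inf _ _ _ _ (i, j)).
Qed.

(** Indexing by all sets, with the empty family attached to those outside
    [Om], avoids a subtype. *)
Lemma singletons_decomposition (n : nat) (Om : {set {set 'I_n}}) :
  interval_decomposition Om (fun S : {set 'I_n} => Om :&: [set S]).
Proof.
split=> [S A B C|].
  rewrite !inE => /andP[AOm /eqP AS] /andP[_ /eqP BS] sAC sCB.
  suff -> : C = A by rewrite AOm AS eqxx.
  by apply/eqP; rewrite eqEsubset sAC AS -{1}BS sCB.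
apply/setP=> S; apply/idP/bigcupP => [SOm|[A _]]; last by case/setIP.
by exists S; rewrite // !inE SOm eqxx.
Qed.

Theorem proposition3 (R : realType) (n : nat) (Om : {set {set 'I_n}}) :
  (exists (K : finType) (Omk : K -> {set {set 'I_n}}),
      interval_decomposition Om Omk) /\
  (forall (K : finType) (Omk : K -> {set {set 'I_n}}),
      interval_decomposition Om Omk ->
      [/\ forall x : {ffun 'I_n -> bool},
            x \in indicators Om <->
            exists z : {ffun K -> bool}, feasible Omk x z,
          forall (x : {ffun 'I_n -> bool}) (z : {ffun K -> bool}) (k : K),
            feasible Omk x z -> z k = true -> x \in indicators (Omk k)
        & forall f : {ffun 'I_n -> bool} -> R,
            min_value (fun x => x \in indicators Om) f =
            min_value
              (fun xz : {ffun 'I_n -> bool} * {ffun K -> bool} =>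
                 feasible Omk xz.1 xz.2)
              (fun xz => f xz.1)]).
Proof.
split.
  by exists {set 'I_n}, (fun S => Om :&: [set S]);
     apply: singletons_decomposition.
move=> K Omk [itv OmE].
have exact x : x \in indicators Om <->
    exists z : {ffun K -> bool}, feasible Omk x z.
  rewrite mem_indicators OmE; split=> [/bigcupP[k _ Sk]|[z]].
    exists [ffun j => j == k]; apply/feasibleP => //.
    by exists k; rewrite ?mem_indicators.
  case/(feasibleP _ _ itv)=> k _; rewrite mem_indicators => Sk.
  by apply/bigcupP; exists k.
split=> // [x z k /(feasibleP _ _ itv)[j -> xj]|f].
  by rewrite ffunE => /eqP->.
exact: min_value_projection.
Qed.
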